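(* Let $N$, $l$ and $m$ be positive integers such that $l\le N-1$ and $1\le m\le N$. Let $B_1,\ldots,B_N$ be independent identically distributed random variables with $\mathrm{Prob}(B_n=1)=\frac{m}{N}$ and $\mathrm{Prob}(B_n=0)=1-\frac{m}{N}$, and let $$\widetilde{X}_l(m,N)=\sum_{n=1}^N\exp\left(-\frac{2jnl\pi}{N}\right)B_n=\widetilde{U}_l(m,N)+j\widetilde{V}_l(m,N),$$ where $j$ is the imaginary unit and $\widetilde{U}_l(m,N)$, $\widetilde{V}_l(m,N)$ are the real and imaginary parts of $\widetilde{X}_l(m,N)$. Then $$\mathbb{E}[\widetilde{X}_l(m,N)]=\mathbb{E}[\widetilde{U}_l(m,N)]=\mathbb{E}[\widetilde{V}_l(m,N)]=0.$$ If in addition $N\neq 2l$, then $$\mathrm{Var}[\widetilde{X}_l(m,N)]=\frac{m(N-m)}{N}$$ and $$\mathrm{Var}[\widetilde{U}_l(m,N)]=\mathrm{Var}[\widetilde{V}_l(m,N)]=\frac{m(N-m)}{2N}.$$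
   Context: Here $j$ denotes the imaginary unit ($j^2=-1$). Explicitly, $\widetilde{U}_l(m,N)=\sum_{n=1}^N\cos\left(\frac{2nl\pi}{N}\right)B_n$ and $\widetilde{V}_l(m,N)=-\sum_{n=1}^N\sin\left(\frac{2nl\pi}{N}\right)B_n$. For a complex-valued random variable $X$, $\mathrm{Var}[X]=\mathbb{E}\left[|X-\mathbb{E}[X]|^2\right]$. *)

(* Defs.v *)
From mathcomp Require Import all_boot all_order all_algebra.
From mathcomp Require Import complex.
From mathcomp Require Import all_classical all_reals all_analysis.

Set Implicit Arguments.
Unset Strict Implicit.
Unset Printing Implicit Defensive.

Import Order.TTheory GRing.Theory Num.Theory.
Import numFieldNormedType.Exports.
Import ComplexField.Normc.

Local Open Scope classical_set_scope.
Local Open Scope complex_scope.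
Local Open Scope ring_scope.

Definition mutually_independent (R : realType) (d : measure_display)
    (T : measurableType d) (P : probability T R) (I : finType)
    (B : I -> {RV P >-> R}) : Prop :=
  forall (J : {set I}) (A : I -> set R),
    (forall i, measurable (A i)) ->
    P (\bigcap_(i in [set` J]) B i @^-1` A i) =
      (\prod_(i in J) P (B i @^-1` A i))%E.
Arguments mutually_independent {R d T} P {I} B.

Definition identically_distributed (R : realType) (d : measure_display)
    (T : measurableType d) (P : probability T R) (I : finType)
    (B : I -> {RV P >-> R}) : Prop :=
  forall (i j : I) (A : set R), measurable A ->
    distribution P (B i) A = distribution P (B j) A.
Arguments identically_distributed {R d T} P {I} B.

Definition cexp (R : realType) (z : R[i]) : R[i] :=
  (expR (complex.Re z))%:C * (cos (complex.Im z) +i* sin (complex.Im z)).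

(* [fine] sends an infinite or undefined expectation to 0, so this is the
   expectation of X only when Re X and Im X are integrable. *)
Definition cexpectation (R : realType) (d : measure_display)
    (T : measurableType d) (P : probability T R) (X : T -> R[i]) : R[i] :=
  fine ('E_P[fun w => complex.Re (X w)])%E +i* fine ('E_P[fun w => complex.Im (X w)])%E.

Definition cvariance (R : realType) (d : measure_display)
    (T : measurableType d) (P : probability T R) (X : T -> R[i]) : \bar R :=
  ('E_P[fun w => (normc (X w - cexpectation P X) ^+ 2)%R])%E.

(* The indices n = 1, ..., N are represented by n = i.+1 with i : 'I_N. *)
Definition Xtilde (R : realType) (T : Type) (N l : nat) (B : 'I_N -> T -> R)
    (w : T) : R[i] :=
  \sum_(i < N)
    cexp (- (2 * 'i%C * i.+1%:R * l%:R * pi%:C / N%:R)) * (B i w)%:C.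

Definition Utilde (R : realType) (T : Type) (N l : nat) (B : 'I_N -> T -> R)
    (w : T) : R := complex.Re (Xtilde l B w).

Definition Vtilde (R : realType) (T : Type) (N l : nat) (B : 'I_N -> T -> R)
    (w : T) : R := complex.Im (Xtilde l B w).

Lemma Xtilde_term (R : realType) (N l n : nat) (b : R) :
  cexp (- (2 * 'i%C * n%:R * l%:R * pi%:C / N%:R)) * b%:C =
  (cos (2 * n%:R * l%:R * pi / N%:R) * b)
    +i* (- (sin (2 * n%:R * l%:R * pi / N%:R) * b)).
Proof.
set t : R := 2 * n%:R * l%:R * pi / N%:R.
have natC k : k%:R = (k%:R : R)%:C :> R[i] by rewrite rmorph_nat.
have -> : - (2 * 'i%C * n%:R * l%:R * pi%:C / N%:R) = 0 +i* (- t) :> R[i].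
  have -> : 2 * 'i%C * n%:R * l%:R * pi%:C / N%:R = 'i%C * t%:C :> R[i].
    by rewrite (mulrC 2) !natC -fmorphV -!mulrA -!rmorphM !mulrA.
  by rewrite /t; simpc.
by rewrite /cexp /= expR0 cosN sinN; simpc.
Qed.

Lemma Utilde_sum_cos (R : realType) (T : Type) (N l : nat)
    (B : 'I_N -> T -> R) (w : T) :
  Utilde l B w =
  \sum_(i < N) cos (2 * i.+1%:R * l%:R * pi / N%:R) * B i w.
Proof.
rewrite /Utilde /Xtilde raddf_sum; apply: eq_bigr => i _.
by rewrite Xtilde_term.
Qed.

Lemma Vtilde_sum_sin (R : realType) (T : Type) (N l : nat)
    (B : 'I_N -> T -> R) (w : T) :
  Vtilde l B w =
  - \sum_(i < N) sin (2 * i.+1%:R * l%:R * pi / N%:R) * B i w.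
Proof.
rewrite /Vtilde /Xtilde raddf_sum -sumrN; apply: eq_bigr => i _.
by rewrite Xtilde_term.
Qed.

(* Main.v *)
(* With theta = 2 pi l / N, the variables U and V are linear forms in the B_n
   with coefficients cos (n theta) and - sin (n theta). Both families of
   coefficients sum to 0 because 2 sin (theta / 2) times the sum telescopes and
   sin (theta / 2) <> 0, so the means vanish and the variances are the second
   moments. As E[B_i B_j] is p^2 off the diagonal and p on it, the quadratic
   form of coefficients c_ij has mean
   p^2 (sum_ij c_ij) + p (1 - p) (sum_i c_ii); here the first sum is 0, and the
   diagonal sums are N / 2 by the double angle formula and the same telescoping
   for 2 theta, which is where N <> 2 l enters. *)

Require Import Defs.
From mathcomp Require Import all_boot all_order all_algebra.
From mathcomp Require Import complex.
From mathcomp Require Import all_classical all_reals all_analysis.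
From mathcomp Require Import measurable_realfun.
From mathcomp Require Import ring lra.

Set Implicit Arguments.
Unset Strict Implicit.
Unset Printing Implicit Defensive.

Import Order.TTheory GRing.Theory Num.Theory.
Import numFieldNormedType.Exports.

Local Open Scope classical_set_scope.
Local Open Scope ring_scope.

(** * Sums of cosines and sines over equally spaced angles *)

Section trigonometric_sums.
Context {R : realType}.
Implicit Types (x : R) (N k n : nat).

Lemma sinDnatpi n x : sin (x + n%:R * pi) = (-1) ^+ n * sin x.
Proof. by rewrite mulr_natl (alternatingn (@sinDpi R)). Qed.

Lemma cosDnatpi n x : cos (x + n%:R * pi) = (-1) ^+ n * cos x.
Proof. by rewrite mulr_natl (alternatingn (@cosDpi R)). Qed.

(** By product to sum, each term times [2 * sin x] is a difference of sines at consecutive odd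
    multiples of [x]. Taking the half step [x] as parameter avoids halving angles. *)
Lemma sum_cos_telescope N x :
  2 * sin x * \sum_(i < N) cos (i.+1%:R * (2 * x)) =
  sin (x + N%:R * (2 * x)) - sin x.
Proof.
elim: N => [|N IH]; first by rewrite big_ord0 mul0r addr0 mulr0 subrr.
rewrite big_ord_recr /= mulrDr IH.
(* Both endpoints become the new angle minus or plus [x], so the addition formulas close the
   step. *)
have -> : x + N%:R * (2 * x) = N.+1%:R * (2 * x) - x by rewrite -natr1; ring.
by rewrite sinB sinD; ring.
Qed.

Lemma sum_sin_telescope N x :
  2 * sin x * \sum_(i < N) sin (i.+1%:R * (2 * x)) =
  cos x - cos (x + N%:R * (2 * x)).
Proof.
elim: N => [|N IH]; first by rewrite big_ord0 mul0r addr0 mulr0 subrr.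
rewrite big_ord_recr /= mulrDr IH.
have -> : x + N%:R * (2 * x) = N.+1%:R * (2 * x) - x by rewrite -natr1; ring.
by rewrite cosB cosD; ring.
Qed.

(** The angle lies strictly between 0 and 2 pi, where the sine vanishes only at pi. The range up to
    [2 * N] serves both [k = l] and [k = 2 * l]. *)
Lemma sin_rational_neq0 N k : (0 < N)%N -> (0 < k)%N -> (k < 2 * N)%N ->
  k <> N -> sin (k%:R * pi / N%:R) != 0 :> R.
Proof.
have H n : (0 < n < N)%N -> 0 < sin (n%:R * pi / N%:R) :> R.
  move=> /andP[n0 nN]; have N0 : (0 < N)%N by exact: leq_trans nN.
  apply: sin_gt0_pi; rewrite divr_gt0 ?mulr_gt0 ?ltr0n ?pi_gt0 ?n0 ?N0//=.
  by rewrite ltr_pdivrMr ?ltr0n// mulrC ltr_pM2l ?pi_gt0// ltr_nat.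
move=> N0 k0 k2 /eqP; rewrite neq_ltn => /orP[kN|Nk].
  by rewrite gt_eqF// H// k0 kN.
(* Beyond pi, a shift by pi only changes the sign and leads back to the first case. *)
have -> : k%:R * pi / N%:R = (k - N)%:R * pi / N%:R + 1%:R * pi :> R.
  rewrite natrB ?(ltnW Nk)//; field.
  by rewrite pnatr_eq0 -lt0n.
rewrite sinDnatpi expr1 mulN1r oppr_eq0 gt_eqF// H// subn_gt0 Nk/=.
by rewrite ltn_subLR ?addnn -?mul2n// ltnW.
Qed.

Section roots.
Variables (N k : nat).
Hypotheses (N_gt0 : (0 < N)%N) (k_gt0 : (0 < k)%N) (k_lt : (k < 2 * N)%N)
  (kN : k <> N).

Let s0 : 2 * sin (k%:R * pi / N%:R) != 0 :> R.
Proof. by rewrite mulf_neq0 ?pnatr_eq0// sin_rational_neq0. Qed.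

Let turn : N%:R * (2 * (k%:R * pi / N%:R)) = (2 * k)%:R * pi :> R.
Proof. by rewrite natrM; field; rewrite pnatr_eq0 -lt0n. Qed.

(** The [N] steps make up [k] full turns, so the two ends of the telescoped sum agree; the nonzero
    factor [2 * sin (k%:R * pi / N%:R)] is then cancelled. *)
Lemma sum_cos_eq0 :
  \sum_(i < N) cos (i.+1%:R * (2 * (k%:R * pi / N%:R))) = 0 :> R.
Proof.
apply: (mulfI s0); rewrite mulr0 sum_cos_telescope turn sinDnatpi.
by rewrite exprM sqrrN !expr1n mul1r subrr.
Qed.

Lemma sum_sin_eq0 :
  \sum_(i < N) sin (i.+1%:R * (2 * (k%:R * pi / N%:R))) = 0 :> R.
Proof.
apply: (mulfI s0); rewrite mulr0 sum_sin_telescope turn cosDnatpi.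
by rewrite exprM sqrrN !expr1n mul1r subrr.
Qed.

End roots.

Lemma sum_cos_sqr N (f : 'I_N -> R) : \sum_(i < N) cos (2 * f i) = 0 ->
  \sum_(i < N) cos (f i) ^+ 2 = N%:R / 2.
Proof.
move=> H; have : \sum_(i < N) (cos (f i) ^+ 2 *+ 2 - 1) = 0.
  by rewrite -[RHS]H; apply: eq_bigr => i _; rewrite -cos_mulr2n mulr_natl.
rewrite sumrB sumr_const card_ord sumrMnl => /eqP.
by rewrite subr_eq0 => /eqP; lra.
Qed.

Lemma sum_sin_sqr N (f : 'I_N -> R) : \sum_(i < N) cos (2 * f i) = 0 ->
  \sum_(i < N) sin (f i) ^+ 2 = N%:R / 2.
Proof.
move=> /sum_cos_sqr H.
under eq_bigr do rewrite sin2cos2.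
by rewrite sumrB H sumr_const card_ord; lra.
Qed.

End trigonometric_sums.

(** * Expectations of linear and quadratic forms in Bernoulli variables *)

Section bernoulli_forms.
Context (R : realType) (d : measure_display) (T : measurableType d)
  (P : probability T R).

(** Replacing each [X i] by its indicator leaves the integral unchanged and supplies integrability.
    It is applied to the variables [B i] and, over pairs, to their products. *)
Lemma expectation_sum_ae_indic (I : finType) (X : I -> T -> R)
    (A : I -> set T) (c : I -> R) :
  (forall i, measurable_fun setT (X i)) -> (forall i, measurable (A i)) ->
  (forall i, {ae P, forall w, X i w = \1_(A i) w}) ->
  ('E_P[fun w => (\sum_i c i * X i w)%R] = \sum_i (c i)%:E * P (A i))%E.
Proof.
move=> mX mA XA; rewrite unlock.
rewrite (@ae_eq_integral _ _ _ _ _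
  (fun w => \sum_i (c i)%:E * (\1_(A i) w)%:E)%E)//=.
- rewrite integral_sum//; last first.
    by move=> i; apply: integrableZl => //; exact: integrable_indic.
  apply: eq_bigr => i _; rewrite integralZl//; last exact: integrable_indic.
  by rewrite integral_indic// setIT.
- apply/measurable_EFinP; apply: measurable_sum => i.
  exact: measurable_funM.
- apply: emeasurable_sum => i; apply: emeasurable_funM => //.
  exact/measurable_EFinP.
(* As [I] is finite, one null set serves all indices. *)
- have : {ae P, forall w, forall i, X i w = \1_(A i) w}.
    exact: filter_forall.
  apply: filterS => w Xw _ /=.
  by rewrite -sumEFin; apply: eq_bigr => i _; rewrite Xw EFinM.
Qed.

Variables (I : finType) (B : I -> {RV P >-> R}) (p : R).
Hypotheses (B_indep : mutually_independent P B)
  (B1 : forall i, P [set w | B i w = 1] = p%:E)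
  (B0 : forall i, P [set w | B i w = 0] = (1 - p)%:E).

Let A i := [set w | B i w = 1].

Let measurable_fiber i r : measurable [set w | B i w = r].
Proof. exact: (measurable_funPTI (B i) (measurable_set1 r)). Qed.

(** The fibres over 1 and 0 are disjoint with total mass [p + (1 - p) = 1], so the values outside
    {0, 1} are taken on a null set. *)
Let ae_indic i : {ae P, forall w, B i w = \1_(A i) w}.
Proof.
exists (~` (A i `|` [set w | B i w = 0])); split.
- by apply: measurableC; apply: measurableU; exact: measurable_fiber.
- rewrite [LHS]probability_setC; last first.
    by apply: measurableU; exact: measurable_fiber.
  rewrite measureU; [|exact: measurable_fiber..|].
    rewrite [X in (_ - (X + _))%E]B1 [X in (_ - (_ + X))%E]B0.
    by rewrite -EFinD addrC subrK subrr.
  by rewrite -classical_sets.subset0 => w /= [->] /eqP; rewrite oner_eq0.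
- move=> w /=; apply: contra_not => -[Aw|Bw].
    by rewrite Aw indicE mem_set.
  by rewrite Bw indicE memNset//= /A/= Bw => /esym/eqP; rewrite oner_eq0.
Qed.

Lemma expectation_bernoulli_sum (a : I -> R) :
  ('E_P[fun w => (\sum_i a i * B i w)%R] = (p * \sum_i a i)%R%:E)%E.
Proof.
rewrite (expectation_sum_ae_indic (A := A))//; last first.
  by move=> i; exact: measurable_fiber.
under eq_bigr do rewrite [P _]B1 -EFinM.
by rewrite sumEFin -mulr_suml mulrC.
Qed.

Lemma expectation_bernoulli_quadratic (c : I -> I -> R) :
  ('E_P[fun w => (\sum_i \sum_j c i j * (B i w * B j w))%R])%E =
  (p ^+ 2 * (\sum_i \sum_j c i j) + p * (1 - p) * \sum_i c i i)%:E.
Proof.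
have mI i j : measurable (A i `&` A j).
  by apply: measurableI; exact: measurable_fiber.
have PI i j : P (A i `&` A j) = (p ^+ 2 + p * (1 - p) * (i == j)%:R)%:E.
  have [->|ij] := eqVneq i j.
    by rewrite setIid [LHS]B1 mulr1; congr (_%:E); ring.
  (* Off the diagonal, independence is used for the pair of indices and the value set {1}. *)
  have := @B_indep [set i; j]%SET (fun _ => [set 1])
    (fun _ => measurable_set1 1).
  rewrite big_setU1 ?inE//= big_set1 [in RHS]/preimage.
  rewrite [X in (X * _)%E]B1 [X in (_ * X)%E]B1 -EFinM mulr0 addr0 expr2 => <-.
  congr (P _); apply/seteqP; split=> w /=.
    by move=> [iw jw] k /=; rewrite !inE => /orP[]/eqP->.
  by move=> H; split; apply: H; rewrite /= !inE eqxx ?orbT.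
under [X in ('E_P[X])%E]eq_fun do rewrite pair_bigA/=.
rewrite (expectation_sum_ae_indic (A := fun ij => A ij.1 `&` A ij.2)
  (X := fun ij w => B ij.1 w * B ij.2 w) (fun ij => c ij.1 ij.2))//=.
- rewrite -(pair_bigA _ (fun i j => (c i j)%:E * P (A i `&` A j)))%E/=.
  under eq_bigr do under eq_bigr do rewrite PI -EFinM mulrDr.
  under eq_bigr do rewrite sumEFin.
  rewrite sumEFin; congr (_%:E).
  rewrite !mulr_sumr -big_split/=; apply: eq_bigr => i _.
  rewrite big_split/= -mulr_suml mulrC; congr (_ + _).
  rewrite (bigD1 i)//= eqxx big1 ?addr0 ?mulr1 1?mulrC// => j ji.
  by rewrite eq_sym (negbTE ji) !mulr0.
- by move=> ij; exact: measurable_funM.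
- move=> [i j] /=; apply: filterS2 (ae_indic i) (ae_indic j) => w -> ->.
  by rewrite indicI.
Qed.

End bernoulli_forms.

Lemma variance_centered (R : realType) (d : measure_display)
    (T : measurableType d) (P : probability T R) (X : T -> R) :
  ('E_P[X] = 0 -> 'V_P[X] = 'E_P[fun w => (X w ^+ 2)%R])%E.
Proof.
move=> X0; rewrite /variance covariance.unlock X0; congr expectation.
by apply/funext => w; rewrite /= fctE /= subr0 expr2.
Qed.

(** This turns the complex variance into a real second moment, to which the quadratic form formula
    applies. *)
Lemma cvariance_centered (R : realType) (d : measure_display)
    (T : measurableType d) (P : probability T R) (X : T -> R[i]) :
  cexpectation P X = 0 ->
  cvariance P X =
    ('E_P[fun w => (complex.Re (X w) ^+ 2 + complex.Im (X w) ^+ 2)%R])%E.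
Proof.
move=> X0; rewrite /cvariance X0; congr expectation; apply/funext => w.
rewrite subr0; case: (X w) => a b /=.
by rewrite sqr_sqrtr// addr_ge0 ?sqr_ge0.
Qed.

Theorem proposition2p1 (R : realType) (d : measure_display)
    (T : measurableType d) (P : probability T R) (N l m : nat)
    (B : 'I_N -> {RV P >-> R})
    (N_gt0 : (0 < N)%N) (l_gt0 : (0 < l)%N) (l_le : (l <= N - 1)%N)
    (m_ge1 : (1 <= m)%N) (m_le : (m <= N)%N)
    (B_indep : mutually_independent P B)
    (B_id : identically_distributed P B)
    (B_prob1 : forall n : 'I_N,
      P [set w | B n w = 1] = (m%:R / N%:R)%:E)
    (B_prob0 : forall n : 'I_N,
      P [set w | B n w = 0] = (1 - m%:R / N%:R)%:E) :
  [/\ cexpectation P (Xtilde l B) = 0,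
      ('E_P[Utilde l B] = 0)%E
    & ('E_P[Vtilde l B] = 0)%E] /\
  (N <> (2 * l)%N ->
    [/\ cvariance P (Xtilde l B) = (m%:R * (N%:R - m%:R) / N%:R)%:E,
        ('V_P[Utilde l B])%E = (m%:R * (N%:R - m%:R) / (2 * N%:R))%:E
      & ('V_P[Vtilde l B])%E = (m%:R * (N%:R - m%:R) / (2 * N%:R))%:E]).
Proof.
have lN : (l < N)%N by rewrite (leq_ltn_trans l_le)// subn1 ltn_predL.
have lN2 : (l < 2 * N)%N by rewrite mul2n -addnn ltn_addl.
have l_neq_N : l <> N by move=> lNE; rewrite lNE ltnn in lN.
(* The angle n theta with n = [i.+1], written to expose the half step [l%:R * pi / N%:R]. *)
pose t (i : 'I_N) : R := i.+1%:R * (2 * (l%:R * pi / N%:R)).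
have tE (i : 'I_N) : 2 * i.+1%:R * l%:R * pi / N%:R = t i by rewrite /t; ring.
have UE : Utilde l B = (fun w => \sum_i cos (t i) * B i w).
  apply/funext => w; rewrite Utilde_sum_cos.
  by apply: eq_bigr => i _; rewrite tE.
have VE : Vtilde l B = (fun w => \sum_i - sin (t i) * B i w).
  apply/funext => w; rewrite Vtilde_sum_sin -sumrN.
  by apply: eq_bigr => i _; rewrite tE mulNr.
have cos0 : \sum_i cos (t i) = 0.
  exact: sum_cos_eq0.
have sin0 : \sum_i - sin (t i) = 0.
  rewrite sumrN; apply/eqP; rewrite oppr_eq0; apply/eqP.
  exact: sum_sin_eq0.
have EU : ('E_P[Utilde l B] = 0)%E.
  by rewrite UE (expectation_bernoulli_sum B_prob1 B_prob0) cos0 mulr0.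
have EV : ('E_P[Vtilde l B] = 0)%E.
  by rewrite VE (expectation_bernoulli_sum B_prob1 B_prob0) sin0 mulr0.
have EX : cexpectation P (Xtilde l B) = 0 by rewrite /cexpectation EU EV.
split=> // N2l.
(* Doubling the angles replaces [l] by [2 * l], which is below [2 * N] and differs from [N]. *)
have cos20 : \sum_i cos (2 * t i) = 0.
  transitivity
    (\sum_(i < N) cos (i.+1%:R * (2 * ((2 * l)%:R * pi / N%:R))) : R).
    by apply: eq_bigr => i _; congr cos; rewrite /t natrM; ring.
  apply: sum_cos_eq0 => //; [by rewrite muln_gt0|by rewrite ltn_pmul2l|].
  by move=> /esym.
have cosS := sum_cos_sqr cos20; have sinS := sum_sin_sqr cos20.
have N0 : N%:R != 0 :> R by rewrite pnatr_eq0 -lt0n.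
have sqrE (a : 'I_N -> R) w : (\sum_i a i * B i w) ^+ 2 =
    \sum_i \sum_j a i * a j * (B i w * B j w).
  by rewrite expr2 big_distrlr/=; do 2!apply: eq_bigr => ? _; ring.
have sumsqr (a : 'I_N -> R) : \sum_i a i = 0 -> \sum_i \sum_j a i * a j = 0.
  by move=> a0; rewrite -big_distrlr/= a0 mulr0.
(* With p = m / N, the diagonal term is p (1 - p) N / 2 = m (N - m) / (2 N). *)
have Esqr (a : 'I_N -> R) : \sum_i a i = 0 -> \sum_i a i * a i = N%:R / 2 ->
    ('E_P[fun w => ((\sum_i a i * B i w) ^+ 2)%R])%E =
    (m%:R * (N%:R - m%:R) / (2 * N%:R))%:E.
  move=> a0 a2; under eq_fun do rewrite sqrE.
  rewrite (expectation_bernoulli_quadratic B_indep B_prob1 B_prob0).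
  by rewrite sumsqr// a2; congr (_%:E); field.
have sinS' : \sum_i - sin (t i) * - sin (t i) = N%:R / 2.
  by rewrite -sinS; apply: eq_bigr => i _; rewrite mulrNN expr2.
split.
- rewrite cvariance_centered//.
  (* The squared modulus is treated as a single quadratic form; its diagonal sum is N / 2 + N / 2 =
     N. *)
  transitivity ('E_P[fun w => (\sum_i \sum_j (cos (t i) * cos (t j) +
      - sin (t i) * - sin (t j)) * (B i w * B j w))%R])%E.
    congr expectation; apply/funext => w.
    rewrite -[complex.Re _]/(Utilde l B w) -[complex.Im _]/(Vtilde l B w) UE VE.
    rewrite !sqrE -big_split/=; apply: eq_bigr => i _; rewrite -big_split/=.
    by apply: eq_bigr => j _; rewrite [RHS]mulrDl.
  rewrite (expectation_bernoulli_quadratic B_indep B_prob1 B_prob0).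
  under eq_bigr do rewrite big_split/=.
  by rewrite !big_split/= !sumsqr// sinS' cosS; congr (_%:E); field.
- by rewrite variance_centered// UE Esqr.
- by rewrite variance_centered// VE Esqr.
Qed.
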